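(* Let $M$ be a compact Hermitian symplectic manifold. Let $\alpha$ be a smooth $1$-form on $M$ which is $d$-exact and $d^c$-closed (or $d^c$-exact and $d$-closed). Then $\alpha=0$.
   Context: A Hermitian symplectic manifold is a complex manifold $(M,I)$ together with a (real, closed, non-degenerate) symplectic form $\omega$ whose $(1,1)$-component $\omega^{1,1}$ in the Hodge decomposition is Hermitian, i.e. $h(\cdot,\cdot):=\omega^{1,1}(\cdot,I\cdot)$ is a Riemannian metric on $M$. The complex structure $I$ acts on differential forms by the induced multiplicative action (trivially on functions), and $d^c:=IdI^{-1}$. A form is $d^c$-exact if it equals $d^c\beta$ for some smooth form $\beta$, and $d^c$-closed if $d^c$ annihilates it. *)

(* Defs.v *)
From mathcomp Require Import all_boot all_order all_algebra.
From mathcomp Require Import all_classical all_reals all_analysis.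
From mathcomp Require Import complex.
Import Order.TTheory GRing.Theory Num.Theory.
Import numFieldNormedType.Exports.

Set Implicit Arguments.
Unset Strict Implicit.
Unset Printing Implicit Defensive.

Local Open Scope classical_set_scope.
Local Open Scope ring_scope.
Local Open Scope complex_scope.

(* C^n is represented by the real vector space R^n x R^n, the row (x, y)       *)
(* standing for x + i y; [Jstd] is multiplication by i.                        *)
Definition Jstd (R : realType) (n : nat) (v : 'rV[R]_(n + n)) : 'rV[R]_(n + n) :=
  row_mx (- rsubmx v) (lsubmx v).

(* Frechet differentiable with a C-linear derivative.                          *)
Definition complex_differentiable (R : realType) (n : nat)
    (f : 'rV[R]_(n + n) -> 'rV[R]_(n + n)) (x : 'rV[R]_(n + n)) : Prop :=
  differentiable f x /\ forall v, 'd f x (Jstd v) = Jstd ('d f x v).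

(* [C_on U k f]: f is of class C^k on the set U, which is meant to be open.    *)
Fixpoint C_on (R : realType) (m : nat) (U : set 'rV[R]_m) (k : nat)
    (f : 'rV[R]_m -> R) : Prop :=
  match k with
  | 0 => forall x, U x -> {for x, continuous f}
  | k'.+1 => (forall x, U x -> differentiable f x) /\
             (forall v, C_on U k' ('D_v f))
  end.

Definition smooth_on (R : realType) (m : nat) (U : set 'rV[R]_m)
    (f : 'rV[R]_m -> R[i]) : Prop :=
  forall k, C_on U k (fun x => complex.Re (f x)) /\
            C_on U k (fun x => complex.Im (f x)).

Definition cderive (R : realType) (m : nat) (v : 'rV[R]_m)
    (f : 'rV[R]_m -> R[i]) (x : 'rV[R]_m) : R[i] :=
  'D_v (fun y => complex.Re (f y)) x +i* 'D_v (fun y => complex.Im (f y)) x.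

(* A complex manifold of complex dimension n with underlying space M, given by *)
(* a holomorphic atlas. The values of [coord c] outside [dom c], and those of  *)
(* [param c] outside [coord c @` dom c], are irrelevant.                       *)
Record complex_manifold (R : realType) (n : nat) (M : topologicalType) := {
  chart : Type;
  dom : chart -> set M;
  coord : chart -> M -> 'rV[R]_(n + n);
  param : chart -> 'rV[R]_(n + n) -> M;
  manifold_hausdorff : hausdorff_space M;
  manifold_second_countable : @second_countable M;
  dom_open : forall c, open (dom c);
  dom_cover : forall p, exists c, dom c p;
  img_open : forall c, open (coord c @` dom c);
  coordK : forall c p, dom c p -> param c (coord c p) = p;
  coord_continuous : forall c, {within dom c, continuous (coord c)};
  param_continuous :
    forall c, {within coord c @` dom c, continuous (param c)};
  transition_holomorphic : forall c c' x,
    (coord c @` (dom c `&` dom c')) x ->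
    complex_differentiable (coord c' \o param c) x
}.

Section Forms.
Variables (R : realType) (n : nat) (M : topologicalType).
Variable X : complex_manifold R n M.

Notation V := 'rV[R]_(n + n).

Definition img (c : chart X) : set V := coord c @` dom c.

Definition transition (c c' : chart X) : V -> V := coord c' \o param c.

(* Raw data of a complex-valued covariant k-tensor field: its expression in    *)
(* every chart c, as a function of the point of [img c] and of k tangent       *)
(* vectors. Values at points outside [img c] are irrelevant, so tensor fields  *)
(* are compared with [tensor_eq].                                              *)
Definition tensor (k : nat) := chart X -> V -> ('I_k -> V) -> R[i].

Definition tensor_eq k (s t : tensor k) : Prop :=
  forall c x v, img c x -> s c x v = t c x v.

Definition tensor0 k : tensor k := fun _ _ _ => 0.
Arguments tensor0 {k}.

Definition multilinear k (t : ('I_k -> V) -> R[i]) : Prop :=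
  forall (v : 'I_k -> V) i (a : R) (u u' : V),
    t (dfwith v i (a *: u + u')) =
    a%:C * t (dfwith v i u) + t (dfwith v i u').

Definition alternating k (t : ('I_k -> V) -> R[i]) : Prop :=
  forall (v : 'I_k -> V) i j, i != j -> v i = v j -> t v = 0.

(* The expressions in two charts are related by pullback along the transition  *)
(* map.                                                                        *)
Definition compatible k (t : tensor k) : Prop :=
  forall c c' x v, (coord c @` (dom c `&` dom c')) x ->
    t c x v = t c' (transition c c' x)
                (fun j => 'd (transition c c') x (v j)).

Definition smooth_tensor k (t : tensor k) : Prop :=
  [/\ forall c x, img c x -> multilinear (t c x),
      compatible t &
      forall c v, smooth_on (img c) (fun x => t c x v)].

Definition smooth_form k (w : tensor k) : Prop :=
  smooth_tensor w /\ forall c x, img c x -> alternating (w c x).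

Definition real_tensor k (t : tensor k) : Prop :=
  forall c x v, img c x -> complex.Im (t c x v) = 0.

(* The usual formula for the exterior derivative evaluated on constant vector  *)
(* fields of a chart.                                                          *)
Definition ext_d k (w : tensor k) : tensor k.+1 := fun c x v =>
  \sum_(i < k.+1) (-1) ^+ i *
    cderive (v i) (fun y => w c y (fun j => v (lift i j))) x.

(* The multiplicative action of the complex structure and its inverse.         *)
Definition I_act k (w : tensor k) : tensor k :=
  fun c x v => w c x (fun j => Jstd (v j)).

Definition I_inv k (w : tensor k) : tensor k :=
  fun c x v => w c x (fun j => - Jstd (v j)).

Definition ext_dc k (w : tensor k) : tensor k.+1 := I_act (ext_d (I_inv w)).

Definition d_closed k (w : tensor k) : Prop :=
  tensor_eq (ext_d w) tensor0.
Definition dc_closed k (w : tensor k) : Prop :=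
  tensor_eq (ext_dc w) tensor0.

Definition d_exact k (w : tensor k.+1) : Prop :=
  exists b : tensor k, smooth_form b /\ tensor_eq w (ext_d b).
Definition dc_exact k (w : tensor k.+1) : Prop :=
  exists b : tensor k, smooth_form b /\ tensor_eq w (ext_dc b).

(* Complexified tangent vectors, and the components v^{1,0} = (v - i J v) / 2  *)
(* and v^{0,1} = (v + i J v) / 2 of a real vector v.                           *)
Definition complexify (v : V) : 'rV[R[i]]_(n + n) :=
  map_mx (fun a => a%:C) v.

Definition part10 (v : V) : 'rV[R[i]]_(n + n) :=
  2^-1 *: (complexify v - 'i%C *: complexify (Jstd v)).

Definition part01 (v : V) : 'rV[R[i]]_(n + n) :=
  2^-1 *: (complexify v + 'i%C *: complexify (Jstd v)).

(* The C-multilinear extension of a R-multilinear t to complex tangent         *)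
(* vectors: expand each argument as Re + i Im.                                 *)
Definition cextend k (t : ('I_k -> V) -> R[i])
    (Z : 'I_k -> 'rV[R[i]]_(n + n)) : R[i] :=
  \sum_(S : {set 'I_k}) 'i%C ^+ #|S| *
    t (fun j => if j \in S then map_mx (@complex.Im R) (Z j)
                else map_mx (@complex.Re R) (Z j)).

(* The (p,q)-component in the Hodge decomposition: expand each argument as     *)
(* v^{1,0} + v^{0,1} and keep the terms with exactly p arguments of type (1,0).*)
Definition hodge_part (p q : nat) (w : tensor (p + q)) : tensor (p + q) :=
  fun c x v => \sum_(S : {set 'I_(p + q)} | #|S| == p)
    cextend (w c x) (fun j => if j \in S then part10 (v j) else part01 (v j)).

Definition pair_vec (u v : V) : 'I_2 -> V := fun j => if j == ord0 then u else v.

Definition nondegenerate (w : tensor 2) : Prop :=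
  forall c x u, img c x ->
    (forall v, w c x (pair_vec u v) = 0) -> u = 0.

Definition symplectic_form (w : tensor 2) : Prop :=
  [/\ smooth_form w, real_tensor w, d_closed w & nondegenerate w].

(* [0 < z] in R[i] means that z is real and positive.                          *)
Definition riemannian_metric (h : tensor 2) : Prop :=
  [/\ smooth_tensor h, real_tensor h,
      forall c x u v, img c x -> h c x (pair_vec u v) = h c x (pair_vec v u) &
      forall c x u, img c x -> u != 0 -> 0 < h c x (pair_vec u u)].

(* h(u, v) = w(u, I v) *)
Definition metric_of (w : tensor 2) : tensor 2 :=
  fun c x v => w c x (pair_vec (v ord0) (Jstd (v ord_max))).

Definition hermitian_symplectic (w : tensor 2) : Prop :=
  symplectic_form w /\ riemannian_metric (metric_of (@hodge_part 1 1 w)).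

End Forms.

Arguments tensor0 {R n M X k}.

(* Main.v *)
Require Import Defs.
From mathcomp Require Import all_boot all_order all_algebra.
From mathcomp Require Import all_classical all_reals all_analysis.
From mathcomp Require Import complex ring lra.
Import Order.TTheory GRing.Theory Num.Theory.
Import numFieldNormedType.Exports.
(* So that [coord] and [coord_continuous] refer to the charts of a manifold. *)
Import Defs.

Set Implicit Arguments.
Unset Strict Implicit.
Unset Printing Implicit Defensive.
Local Open Scope classical_set_scope.
Local Open Scope ring_scope.
Local Open Scope complex_scope.

(** The statement follows from the maximum principle. If [alpha = d f] is
    [d^c]-closed, evaluating [d^c d f] on [(v, J v)] in a holomorphic chart
    gives [D_v D_v f + D_(Jv) D_(Jv) f = 0] for every constant vector [v]: the
    real and imaginary parts of [f] are harmonic along every complex line, that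
    is, pluriharmonic. If [alpha = d^c f] is [d]-closed, then [d d^c f] gives
    the same equation. It therefore suffices to prove that a pluriharmonic
    function [u] on a compact complex manifold is locally constant
    ([pluriharmonic_locally_constant]); no metric or symplectic form enters.

    On the connected component [C] of a point, [u] attains a maximum [m]. The
    set of points of [C] where [u = m] is closed in [C] by continuity and open
    by the strong maximum principle in a chart
    ([pluriharmonic_strong_maximum]), so it is all of [C]. Charts also show
    that components are open, through segments in the image of a chart.

    The strong maximum principle is obtained by a barrier of Hopf type, without
    mean values. If [g] is pluriharmonic, [g <= m] and the set [g = m] touches
    from outside, at [y], a Euclidean ball on which [g < m], shrink the ball
    (centre [z], squared radius [r]) so that [y] is its only common point with
    [g = m], and put [h = (t - r) (t - 2 r)] with [t = |x - z|^2]. This [h]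
    vanishes at [y], is negative just outside the ball, and bounded inside. For
    small [eps > 0] the function [g + eps h] is below [m] on a small sphere
    around [y] and equals [m] at [y], hence has an interior maximum [c]. With
    [w = c - z], the second derivatives of [g] at [c] along [w] and [J w] cancel
    and those of [h] add up to [4 t (4 t - 3 r)], because [J w] is orthogonal to
    [w] and of the same length; as [t] is close to [r], this is positive, which
    contradicts the second derivative test
    ([pluriharmonic_barrier_no_local_max]). *)

(** * Second derivative test along a line *)

Lemma second_derivative_local_max (R : realType) (f : R -> R) :
  (\forall s \near 0, derivable f s 1) -> derivable ('D_1 f) 0 1 ->
  (\forall s \near 0, f s <= f 0) -> 'D_1 ('D_1 f) 0 <= 0.
Proof.
move=> df ddf fmax.
have [e /= e0 he] : exists2 e : R, 0 < e &
    forall s, `|s| < e -> derivable f s 1 /\ f s <= f 0.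
  have : \forall s \near 0, derivable f s 1 /\ f s <= f 0.
    by near=> s; split; near: s.
  move=> /nbhs_ballP[e /= e0 he]; exists e => // s se.
  by apply: he; rewrite /ball /= sub0r normrN.
have f'0 : 'D_1 f 0 = 0.
  have : is_derive (0 : R) 1 f 0.
    apply: (@derive1_at_max _ f (- e) e 0).
    - by lra.
    - by move=> t; rewrite in_itv /= -ltr_norml => /he[].
    - by rewrite in_itv /= oppr_lt0 e0.
    - by move=> t; rewrite in_itv /= -ltr_norml => /he[].
  by move=> h; rewrite derive_val.
(* Otherwise the derivative is positive just to the right of 0, and the mean
   value theorem makes f exceed f 0 there. *)
rewrite leNgt; apply/negP => D0.
have [d /= d0 hd] : exists2 d : R, 0 < d &
    forall s, 0 < s -> s < d -> 0 < 'D_1 f s.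
  have /cvgrPdist_lt/(_ _ D0) := ddf.
  rewrite -/(derive _ _ _) => /nbhs_ballP[d /= d0 hd]; exists d => // s s0 sd.
  have sn0 : s != 0 by rewrite gt_eqF.
  have := hd s; rewrite /ball /= sub0r normrN gtr0_norm// => /(_ sd sn0).
  rewrite addr0 f'0 subr0 ltr_distl.
  rewrite [_ *: 1]mulr1 => /andP[_]; rewrite -ltrBlDr subrr => h.
  have := mulr_gt0 h s0; rewrite [_ *: _]mulrC mulfVK//.
pose s := Num.min d e / 2.
have m0 : 0 < Num.min d e by rewrite lt_min d0 e0.
have s0 : 0 < s by rewrite divr_gt0.
have sm : s < Num.min d e by rewrite /s; lra.
have /andP[sd se] : (s < d) && (s < e) by rewrite -lt_min.
have [||t] := @MVT _ f ('D_1 f) 0 s s0.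
- move=> x; rewrite in_itv /= => /andP[x0 xs]; apply: derivableP.
  by apply: (he x _).1; rewrite gtr0_norm// (lt_trans xs).
- apply: derivable_within_continuous => x; rewrite in_itv /= => /andP[x0 xs].
  by apply: (he x _).1; rewrite ger0_norm// (le_lt_trans xs).
- rewrite in_itv /= subr0 => /andP[t0 ts] fsE.
  have : 0 < f s - f 0 by rewrite fsE mulr_gt0// hd// (lt_trans ts).
  have /he[_] : `|s| < e by rewrite gtr0_norm.
  lra.
Unshelve. all: by end_near. Qed.

Lemma continuous_line (R : realType) (V : normedModType R) (y w : V) :
  continuous (fun s : R => y + s *: w).
Proof.
by move=> s; apply: cvgD; [exact: cvg_cst|apply: cvgZl; exact: cvg_id].
Qed.

Lemma cvg_line (R : realType) (V : normedModType R) (y w : V) :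
  (fun s : R => y + s *: w) @ (0 : R) --> y.
Proof.
have := @continuous_line R V y w 0.
by rewrite /continuous_at scale0r addr0.
Qed.

Lemma is_derive_along (R : realType) (V : normedModType R) (g : V -> R)
    (y w : V) (s : R) : derivable g (y + s *: w) w ->
  is_derive s 1 (fun t => g (y + t *: w)) ('D_w g (y + s *: w)).
Proof.
have E : (fun h : R => h^-1 *: (g (y + (h *: 1 + s) *: w) - g (y + s *: w)))
       = (fun h : R => h^-1 *: (g (h *: w + (y + s *: w)) - g (y + s *: w))).
  apply: funext => h; rewrite [h *: 1]mulr1 scalerDl.
  by rewrite addrCA.
move=> dg; apply: DeriveDef; last by rewrite /derive /= E.
by rewrite /derivable /= E.
Qed.

(** The second derivative test along [w] for [g + p], where [p] is a function of
    the parameter of the line only, given by a polynomial. *)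
Lemma directional_second_derivative_local_max (R : realType)
    (V : normedModType R) (g : V -> R) (p : {poly R}) (y w : V) :
  (\forall x \near y, derivable g x w) -> derivable ('D_w g) y w ->
  (\forall s \near (0 : R), g (y + s *: w) + p.[s] <= g y + p.[0]) ->
  'D_w ('D_w g) y + p`_2 *+ 2 <= 0.
Proof.
have <- : (p^`()^`()).[0] = p`_2 *+ 2.
  by rewrite horner_coef0 !coef_deriv mulr1n.
move=> dg ddg gmax.
pose f s := g (y + s *: w) + p.[s].
have lineC := @cvg_line _ _ y w.
have df : \forall s \near (0 : R),
    @is_derive R R R s 1 f ('D_w g (y + s *: w) + p^`().[s]).
  near=> s.
  have dgs : derivable g (y + s *: w) w.
    by near: s; exact: (lineC _ dg).
  have := is_derive_along dgs => h.
  have hp : @is_derive R R R s 1 (horner p) (p^`().[s]).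
    by apply: DeriveDef; [exact: derivable_horner|rewrite (derivE p) derive1E].
  exact: is_deriveD.
have ddf : is_derive (0 : R) 1 (fun s => 'D_w g (y + s *: w) + p^`().[s])
    ('D_w ('D_w g) y + p^`()^`().[0]).
  have y0 : y + 0 *: w = y by rewrite scale0r addr0.
  rewrite -[in 'D_w _ y]y0.
  have h : is_derive (0:R) 1 (fun s => 'D_w g (y + s *: w))
       ('D_w ('D_w g) (y + 0 *: w)).
    by apply: is_derive_along; rewrite y0.
  have hp : @is_derive R R R 0 1 (horner p^`()) (p^`()^`().[0]).
    apply: DeriveDef; first exact: derivable_horner.
    by rewrite (derivE p^`()) derive1E.
  exact: is_deriveD.
have f0 : \forall s \near (0 : R), 'D_w g (y + s *: w) + p^`().[s] = 'D_1 f s.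
  near=> s; have h : @is_derive R R R s 1 f ('D_w g (y + s *: w) + p^`().[s]).
    by near: s.
  by rewrite derive_val.
have := near_eq_is_derive f0 ddf => -[ddf1 ddf2].
rewrite -ddf2; apply: second_derivative_local_max => //.
- by near=> s; have [] : @is_derive R R R s 1 f ('D_w g (y + s *: w) + p^`().[s]);
    [near: s|].
- by near=> s; rewrite /f scale0r addr0; near: s.
Unshelve. all: by end_near. Qed.

(** * The Euclidean inner product *)

(** The standard inner product of row vectors. It is needed because the norm of
    a space of matrices is the supremum norm. *)
Definition dot (R : realType) (m : nat) (a b : 'rV[R]_m) : R :=
  \sum_i a 0 i * b 0 i.

Section Dot.
Variables (R : realType) (m : nat).
Implicit Types a b c : 'rV[R]_m.

Lemma dotC a b : dot a b = dot b a.
Proof. by apply: eq_bigr => i _; rewrite mulrC. Qed.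

Lemma dotDl a b c : dot (a + b) c = dot a c + dot b c.
Proof. by rewrite -big_split; apply: eq_bigr => i _; rewrite mxE mulrDl. Qed.

Lemma dotDr a b c : dot c (a + b) = dot c a + dot c b.
Proof. by rewrite dotC dotDl !(dotC c). Qed.

Lemma dot0l a : dot 0 a = 0.
Proof. by apply: big1 => i _; rewrite mxE mul0r. Qed.

Lemma dotZl k a b : dot (k *: a) b = k * dot a b.
Proof. by rewrite mulr_sumr; apply: eq_bigr => i _; rewrite mxE mulrA. Qed.

Lemma dotZr k a b : dot b (k *: a) = k * dot b a.
Proof. by rewrite dotC dotZl dotC. Qed.

Lemma dotNN a : dot (- a) (- a) = dot a a.
Proof. by apply: eq_bigr => i _; rewrite !mxE mulrNN. Qed.

Lemma dot_ge0 a : 0 <= dot a a.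
Proof. by apply: sumr_ge0 => i _; rewrite -expr2 sqr_ge0. Qed.

(** The supremum norm is bounded by the Euclidean norm. *)
Lemma dot_lt_norm a e : 0 <= e -> dot a a < e ^+ 2 -> `|a| < e.
Proof.
move=> e0 ae; have e1 : 0 < e.
  rewrite lt_neqAle e0 andbT; apply/eqP => E.
  by move: ae; rewrite -E expr0n /= ltNge dot_ge0.
rewrite [`|a|]/Num.norm /= mx_normrE; apply/bigmax_ltP; split=> // -[i j] _ /=.
rewrite (ord1 i) -ltr_sqr ?nnegrE// real_normK ?num_real//.
apply: le_lt_trans ae; rewrite /dot (bigD1 j)//= -expr2 lerDl.
by apply: sumr_ge0 => k _; rewrite -expr2 sqr_ge0.
Qed.

Lemma dot_gt0 a : a != 0 -> 0 < dot a a.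
Proof.
move=> a0; rewrite lt_neqAle dot_ge0 andbT; apply/eqP => E.
have n0 : 0 < `|a| by rewrite normr_gt0.
have := @dot_lt_norm a `|a| (ltW n0); rewrite -E ltxx => h.
by have := h (exprn_gt0 _ n0).
Qed.

Lemma continuous_dot b : continuous (fun x : 'rV[R]_m => dot (x - b) (x - b)).
Proof.
apply: (continuous_big (op := +%R)) => [|i _ x]; first exact: add_continuous.
have h : (fun y : 'rV[R]_m => (y - b) 0 i) @ x --> (x - b) 0 i.
  apply: (@continuous_comp _ _ _ (fun y : 'rV[R]_m => y - b)
    (fun M : 'rV[R]_m => M 0 i)).
    by apply: (@continuousB _ _ _ id (cst b));
      [exact: cvg_id|exact: cst_continuous].
  exact: matrix_normedtype.coord_continuous.
exact: (@continuousM R _ (fun y : 'rV[R]_m => (y - b) 0 i)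
  (fun y : 'rV[R]_m => (y - b) 0 i) x h h).
Qed.

Lemma compact_dot_ball b e : compact [set x | dot (x - b) (x - b) <= e].
Proof.
apply: bounded_closed_compact.
  exists (`|b| + (`|e| + 1)); split; first exact: num_real.
  move=> N bN x /= xe; rewrite -(subrK b x).
  apply: (le_trans (ler_normD _ _)); rewrite addrC; apply: le_trans (ltW bN).
  rewrite lerD2l ltW//; apply: dot_lt_norm; first by rewrite addr_ge0.
  apply: (le_lt_trans xe); have := ler_norm e; have := normr_ge0 e; nra.
have -> : [set x | dot (x - b) (x - b) <= e] =
    (fun x : 'rV[R]_m => dot (x - b) (x - b)) @^-1` [set t | t <= e] by [].
apply: (continuous_closedP _).1; [exact: continuous_dot|exact: closed_le].
Qed.

Lemma dot_ball_sub (U : set 'rV[R]_m) b : open U -> U b ->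
  exists2 e : R, 0 < e & forall x, dot (x - b) (x - b) < e -> U x.
Proof.
move=> oU Ub; have /nbhs_ballP[e /= e0 he] : nbhs b U by exact: open_nbhs_nbhs.
exists (e ^+ 2); first exact: exprn_gt0.
move=> x xe; apply: he; rewrite -ball_normE /= distrC.
by apply: dot_lt_norm => //; exact: ltW.
Qed.

Lemma near_dot_ball b e : 0 < e ->
  \forall x \near b, dot (x - b) (x - b) < e.
Proof.
move=> e0; have := @continuous_dot b b.
move=> /(_ [set t | t < e]); apply; apply: open_nbhs_nbhs; split.
  exact: open_lt.
by rewrite /= subrr dot0l.
Qed.

Lemma dot_sqrD a b : dot (a + b) (a + b) = dot a a + 2 * dot a b + dot b b.
Proof. by rewrite dotDl !dotDr (dotC b a); ring. Qed.

(** Young's inequality, used in place of the Cauchy-Schwarz inequality so as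
    to avoid square roots. *)
Lemma dot_young k a b : 2 * k * dot a b <= k ^+ 2 * dot a a + dot b b.
Proof.
have := dot_ge0 (k *: a + (-1) *: b).
by rewrite !(dotDl, dotDr, dotZl, dotZr) (dotC b a); nra.
Qed.

End Dot.

Lemma dot_Jstd (R : realType) n (v : 'rV[R]_(n + n)) :
  dot (Jstd v) (Jstd v) = dot v v.
Proof.
rewrite /dot !big_split_ord /= addrC; congr (_ + _); apply: eq_bigr => i _.
  by rewrite /Jstd !row_mxEr !mxE.
by rewrite /Jstd !row_mxEl !mxE mulrNN.
Qed.

Lemma dot_Jstd_self (R : realType) n (v : 'rV[R]_(n + n)) : dot v (Jstd v) = 0.
Proof.
rewrite /dot big_split_ord /= -big_split big1 //= => i _.
by rewrite /Jstd !row_mxEr !row_mxEl !mxE; ring.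
Qed.

(** * The strong maximum principle for pluriharmonic functions *)

(** Pluriharmonic functions on [U], meant to be open: differentiable functions
    with differentiable derivatives along constant vectors and with vanishing
    Laplacian along every complex line. *)
Definition pluriharmonic_on (R : realType) n (U : set 'rV[R]_(n + n))
    (g : 'rV[R]_(n + n) -> R) : Prop :=
  [/\ forall x, U x -> differentiable g x,
      forall v x, U x -> differentiable ('D_v g) x &
      forall v x, U x ->
        'D_v ('D_v g) x + 'D_(Jstd v) ('D_(Jstd v) g) x = 0].

Section MaximumPrinciple.
Variables (R : realType) (n : nat).
Notation V := 'rV[R]_(n + n).

(** With [t] the squared distance from [x] to [z], the barrier is
    [(t - r) (t - 2 r)]: it vanishes on the sphere of squared radius [r] and is
    negative between this sphere and that of squared radius [2 r]. *)
Definition barrier (z : V) (r : R) (x : V) : R :=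
  (dot (x - z) (x - z) - r) * (dot (x - z) (x - z) - 2 * r).

Lemma continuous_barrier z r : continuous (barrier z r).
Proof.
move=> x; have cd := @continuous_dot R _ z x.
have h k : (fun y : V => dot (y - z) (y - z) - k) @ x -->
    dot (x - z) (x - z) - k.
  by apply: (@continuousB _ _ _ (fun y : V => dot (y - z) (y - z)) (cst k));
    [exact: cd|exact: cst_continuous].
exact: (@continuousM R _ (fun y : V => dot (y - z) (y - z) - r)
  (fun y : V => dot (y - z) (y - z) - 2 * r) x (h _) (h _)).
Qed.

Lemma pluriharmonic_barrier_no_local_max (U : set V) g z y (r e : R) :
  open U -> pluriharmonic_on U g -> U y -> 0 < e ->
  0 < r -> 3 / 4 * r < dot (y - z) (y - z) ->
  ~ (\forall x \near y, g x + e * barrier z r x <= g y + e * barrier z r y).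
Proof.
move=> oU [dg ddg lap] Uy e0 r0 ry hmax.
have [w wE] : exists w, y - z = w by exists (y - z).
rewrite wE in ry.
have [t tE] : exists t, dot w w = t by exists (dot w w).
rewrite tE in ry.
have t0 : 0 < t by clear -ry r0; lra.
have t3 : 0 < 4 * t - 3 * r by clear -ry; lra.
have Uny : \forall x \near y, U x by exact: open_nbhs_nbhs.
have line (v : V) (p : {poly R}) :
    (forall s, e * barrier z r (y + s *: v) = p.[s]) ->
    'D_v ('D_v g) y + p`_2 *+ 2 <= 0.
  move=> hp; apply: directional_second_derivative_local_max.
  - by near=> x; apply/diff_derivable/dg; near: x.
  - exact/diff_derivable/ddg.
  - have lineC := @cvg_line _ _ y v.
    near=> s; rewrite -!hp scale0r addr0.
    by near: s; exact: (lineC _ hmax).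
(* With w = y - z and t = |w|^2, the squared distance to z is (1 + s)^2 t at
   y + s w and (1 + s^2) t at y + s J w; P and S are the restrictions of
   e * barrier to these two lines, as polynomials in s. *)
pose P := Poly [:: e * (t ^+ 2 - 3 * r * t + 2 * r ^+ 2);
  e * (4 * t ^+ 2 - 6 * r * t); e * (6 * t ^+ 2 - 3 * r * t);
  e * (4 * t ^+ 2); e * t ^+ 2].
pose S := Poly [:: e * (t ^+ 2 - 3 * r * t + 2 * r ^+ 2); 0;
  e * (2 * t ^+ 2 - 3 * r * t); 0; e * t ^+ 2].
have Pw : 'D_w ('D_w g) y + P`_2 *+ 2 <= 0.
  apply: line => s; rewrite /barrier addrAC wE.
  rewrite !(dotDl, dotDr, dotZl, dotZr) tE horner_Poly /=.
  by ring.
have Sw : 'D_(Jstd w) ('D_(Jstd w) g) y + S`_2 *+ 2 <= 0.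
  apply: line => s; rewrite /barrier addrAC wE.
  rewrite !(dotDl, dotDr, dotZl, dotZr) (dotC (Jstd w) w) dot_Jstd_self.
  rewrite dot_Jstd tE horner_Poly /=.
  by ring.
rewrite coef_Poly /= in Pw; rewrite coef_Poly /= in Sw.
have : 0 < e * (t * (4 * t - 3 * r)) by rewrite !mulr_gt0.
move: Pw Sw (lap w y Uy).
move: ('D_w ('D_w g) y) ('D_(Jstd w) ('D_(Jstd w) g) y) => a b.
by clear; lra.
Unshelve. all: by end_near. Qed.

(** If [g] has a local maximum at [y], the set [g = g y] cannot touch at [y] a
    ball around [z] from outside. *)
Lemma pluriharmonic_no_touching_ball (U : set V) g y z (e : R) :
  open U -> pluriharmonic_on U g -> 0 < e -> y != z ->
  (forall x, dot (x - y) (x - y) < e -> U x /\ g x <= g y) ->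
  ~ (forall x, dot (x - y) (x - y) < e ->
       dot (x - z) (x - z) < dot (y - z) (y - z) -> g x < g y).
Proof.
move=> oU pg e0 yz hU hlt.
(* The ball with centre z' = y - w, the midpoint of y and z, and squared radius
   r meets the sphere around z through y at y only. *)
have [w wE] : exists w, w = 2^-1 *: (y - z) by exists (2^-1 *: (y - z)).
have [r rE] : exists r, r = dot w w by exists (dot w w).
have r0 : 0 < r.
  rewrite rE dot_gt0// wE scaler_eq0 negb_or subr_eq0 yz andbT.
  by rewrite invr_eq0 pnatr_eq0.
have yzE : y - z = 2 *: w by rewrite wE scalerA mulfV ?scale1r// pnatr_eq0.
pose z' := y - w.
have xz'E x : dot (x - z') (x - z') =
    dot (x - y) (x - y) + 2 * dot (x - y) w + r.
  have -> : x - z' = (x - y) + w by rewrite /z' opprB addrA addrAC.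
  by rewrite dot_sqrD -rE.
have xzE x : dot (x - z) (x - z) =
    dot (x - y) (x - y) + 4 * dot (x - y) w + 4 * r.
  have -> : x - z = (x - y) + 2 *: w by rewrite -yzE addrA subrK.
  by rewrite dot_sqrD !(dotZl, dotZr) -rE; ring.
have yzr : dot (y - z) (y - z) = 4 * r.
  by rewrite yzE dotZl dotZr -rE; ring.
(* The squared radius d is so small that the squared distance to z' stays
   between 3/4 r and 2 r on the ball around y. *)
pose d := Num.min (e / 2) (r / 128).
have d0 : 0 < d by rewrite lt_min !divr_gt0.
have de : d < e.
  by apply: (@le_lt_trans _ _ (e / 2)); [rewrite ge_min lexx|lra].
have dr : d <= r / 128 by rewrite ge_min lexx orbT.
have tr x : dot (x - y) (x - y) <= d ->
    3 / 4 * r < dot (x - z') (x - z') < 2 * r.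
  move=> xd; have h1 := dot_young 8 (x - y) w.
  have h2 := dot_young (-8) (x - y) w.
  rewrite -rE in h1 h2; rewrite xz'E; have := dot_ge0 (x - y).
  by move=> ?; apply/andP; split; lra.
have cg x : dot (x - y) (x - y) <= d -> {for x, continuous g}.
  move=> xd; case: pg => dg _ _; apply: differentiable_continuous; apply: dg.
  by apply: (hU _ _).1; exact: le_lt_trans de.
pose B := [set x : V | dot (x - y) (x - y) <= d].
have cB : compact B by exact: compact_dot_ball.
have within_cont f : (forall x, B x -> {for x, continuous f}) ->
    forall A, A `<=` B -> {within A, continuous (f : V -> R)}.
  move=> fc A AB; apply: continuous_in_subspaceT => x.
  by rewrite inE => /AB/fc.
(* The part of the sphere around y where the barrier may be positive: there g is
   bounded away from its maximum. *)
pose S := [set x : V | dot (x - y) (x - y) = d /\ dot (x - z') (x - z') <= r].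
have SB : S `<=` B by move=> x [xd _]; rewrite /B /= xd.
have cS : compact S.
  apply: (subclosed_compact _ cB) => //.
  apply: closedI.
    apply: (@closed_comp _ _ (fun x : V => dot (x - y) (x - y)) [set d]).
      by move=> x _; exact: continuous_dot.
    exact: closed_eq.
  apply: (@closed_comp _ _ (fun x : V => dot (x - z') (x - z'))
    [set t | t <= r]).
    by move=> x _; exact: continuous_dot.
  exact: closed_le.
have Slt x : S x -> g x < g y.
  move=> [xd xr]; apply: hlt; first by rewrite xd.
  by rewrite yzr xzE; rewrite xz'E in xr; lra.
have [eta eta0 heta] : exists2 eta : R, 0 < eta &
    forall x, S x -> g x <= g y - eta.
  have [[x0 Sx0]|S0] := pselect (S !=set0); last first.
    by exists 1 => // x Sx; exfalso; apply: S0; exists x.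
  have [||c + hc] := @compact_EVT_max _ _ g S _ cS.
  - by exists x0.
  - exact: within_cont.
  - rewrite inE => /Slt gc; exists (g y - g c); first by rewrite subr_gt0.
    by move=> x Sx; rewrite opprB addrC subrK; apply: hc; rewrite inE.
(* On the ball around z' the barrier is at most 2 r^2, so adding eps times it
   raises g by at most half of eta. *)
pose eps := eta / (4 * r ^+ 2).
have eps0 : 0 < eps by rewrite divr_gt0// mulr_gt0// exprn_gt0.
have epsE : eps * (4 * r ^+ 2) = eta.
  by rewrite divfK// mulf_neq0// ?pnatr_eq0// expf_neq0// gt_eqF.
pose F x := g x + eps * barrier z' r x.
have By : B y by rewrite /B /= subrr dot0l ltW.
have Fy : F y = g y.
  rewrite /F /barrier xz'E subrr.
  by rewrite !dot0l; ring.
have [||c + hc] := @compact_EVT_max _ _ F B _ cB.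
- by exists y.
- apply: within_cont => // x Bx; apply: continuousD; first exact: cg.
  by apply: continuousM; [exact: cst_continuous|exact: continuous_barrier].
rewrite inE => Bc.
have Fc : g y <= F c by rewrite -Fy; apply: hc; rewrite inE.
have /andP[tc1 tc2] := tr c Bc.
(* The maximum of F is not attained on the sphere around y. *)
have cd : dot (c - y) (c - y) < d.
  rewrite lt_neqAle Bc andbT; apply/eqP => cdE.
  have gc : g c <= g y by apply: (hU _ _).2; rewrite cdE.
  have [tr'|tr'] := leP (dot (c - z') (c - z')) r.
    have := heta c (conj cdE tr'); move: Fc; rewrite /F /barrier.
    move: (dot (c - z') (c - z')) tc1 tc2 tr' => t *.
    have : (t - r) * (t - 2 * r) <= 2 * r ^+ 2 by nra.
    by rewrite -(ler_pM2l eps0) => ?; nra.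
  move: Fc; rewrite /F /barrier.
  move: (dot (c - z') (c - z')) tc1 tc2 tr' => t *.
  have : (t - r) * (t - 2 * r) < 0 by rewrite pmulr_rlt0; lra.
  by rewrite -(ltr_pM2l eps0) mulr0 => ?; lra.
apply: (@pluriharmonic_barrier_no_local_max U g z' c r eps) => //.
  by apply: (hU _ _).1; exact: lt_trans de.
have : \forall x \near c, dot (x - y) (x - y) < d.
  apply: (@continuous_dot _ _ y c [set t | t < d]); apply: open_nbhs_nbhs.
  by split => //; exact: open_lt.
by apply: filterS => x xd; apply: hc; rewrite inE /B /= ltW.
Qed.

Lemma pluriharmonic_strong_maximum (U : set V) g q :
  open U -> pluriharmonic_on U g -> U q -> (forall x, U x -> g x <= g q) ->
  \forall x \near q, g x = g q.
Proof.
move=> oU pg Uq gq.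
have [e e0 he] := dot_ball_sub oU Uq.
have e16 : 0 < e / 16 by rewrite divr_gt0.
apply: filterS (near_dot_ball q e16) => z zq.
apply: contrapT => gzq.
have gz : g z < g q.
  rewrite lt_neqAle gq ?andbT; last by apply: he; lra.
  exact/eqP.
have tri (a b c : V) : dot (a - c) (a - c) <=
    2 * dot (a - b) (a - b) + 2 * dot (b - c) (b - c).
  have -> : a - c = (a - b) + (b - c) by rewrite addrA subrK.
  have := dot_young 1 (a - b) (b - c).
  by rewrite (dot_sqrD (a - b) (b - c)) expr1n mul1r mulr1; lra.
(* The point y closest to z among those near q where g is maximal is a touching
   point; as q is one of them, y is close to q. *)
pose K := [set x : V | dot (x - q) (x - q) <= e / 4 /\ g x = g q].
have KU x : dot (x - q) (x - q) <= e / 4 -> U x.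
  by move=> xq; apply: he; lra.
have closedK : closed K.
  rewrite -openC openE => x /not_andP xK.
  have [xq|xq] := leP (dot (x - q) (x - q)) (e / 4).
    have gx : g x < g q.
      rewrite lt_neqAle gq ?andbT; last exact: KU.
      by apply/eqP; case: xK.
    have cg : {for x, continuous g}.
      by case: pg => dg _ _; apply/differentiable_continuous/dg/KU.
    have : \forall t \near x, g t < g q.
      apply: (cg [set t | t < g q]); apply: open_nbhs_nbhs.
      by split => //; exact: open_lt.
    by apply: filterS => t tq [_ tE]; rewrite tE ltxx in tq.
  have : \forall t \near x, e / 4 < dot (t - q) (t - q).
    apply: (@continuous_dot _ _ q x [set t | e / 4 < t]).
    by apply: open_nbhs_nbhs; split => //; exact: open_gt.
  by apply: filterS => t tq [/le_lt_trans/(_ tq)]; rewrite ltxx.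
have cK : compact K.
  apply: (subclosed_compact closedK (@compact_dot_ball _ _ q (e / 4))).
  by move=> x [].
have Kq : K q by split=> //; rewrite subrr dot0l; lra.
have [||y + hy] := @compact_EVT_min _ _
  (fun x : V => dot (x - z) (x - z)) K _ cK.
- by exists q.
- by apply: continuous_subspaceT => x; exact: continuous_dot.
rewrite inE => -[yq gy].
have yzq : dot (y - z) (y - z) < e / 16.
  apply: le_lt_trans zq; rewrite -(dotNN (z - q)) opprB.
  by apply: hy; rewrite inE.
apply: (@pluriharmonic_no_touching_ball U g y z (e / 16)) => //.
- by apply/eqP => yz; move: gz; rewrite -yz gy ltxx.
- move=> x xy; have Ux : U x by apply: he; have := tri x y q; lra.
  by split=> //; rewrite gy gq.
- move=> x xy xz; rewrite gy lt_neqAle gq ?andbT; last first.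
    by apply: he; have := tri x y q; lra.
  apply/eqP => gx.
  have : K x.
    split => //; have := tri x z q; lra.
  by move=> Kx; have := hy x; rewrite inE => /(_ Kx); rewrite leNgt xz.
Qed.

End MaximumPrinciple.

Lemma pluriharmonic_subset (R : realType) n (U W : set 'rV[R]_(n + n)) g :
  W `<=` U -> pluriharmonic_on U g -> pluriharmonic_on W g.
Proof.
by move=> WU [h1 h2 h3]; split=> [x /WU|v x /WU|v x /WU];
  [exact: h1|exact: h2|exact: h3].
Qed.

(** * Pluriharmonic functions on compact complex manifolds *)

Section Manifold.
Variables (R : realType) (n : nat) (M : topologicalType).
Variable X : complex_manifold R n M.
Notation V := 'rV[R]_(n + n).

Lemma coord_continuous_at (c : chart X) p :
  dom c p -> {for p, continuous (coord c)}.
Proof.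
move=> cp; have := coord_continuous (c := c).
by rewrite continuous_open_subspace; [apply; rewrite inE|exact: dom_open].
Qed.

Lemma img_coord (c : chart X) p : dom c p -> img c (coord c p).
Proof. by move=> cp; exists p. Qed.

Lemma dom_param (c : chart X) x : img c x -> dom c (param c x).
Proof. by move=> [p cp <-]; rewrite coordK. Qed.

Lemma paramK (c : chart X) x : img c x -> coord c (param c x) = x.
Proof. by move=> [p cp <-]; rewrite coordK. Qed.

(** The points of a chart ball are joined to its centre by the images of
    segments. *)
Lemma param_connected_component (c : chart X) q e :
  dom c q ->
  (forall x, dot (x - coord c q) (x - coord c q) < e -> img c x) ->
  forall x, dot (x - coord c q) (x - coord c q) < e ->
  connected_component setT q (param c x).
Proof.
move=> cq he x xe; set y := coord c q in he xe *.
pose path s := y + s *: (x - y).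
have path_img s : `[0, 1]%classic s -> img c (path s).
  rewrite /= in_itv /= => /andP[s0 s1]; apply: he.
  rewrite /path addrAC subrr add0r dotZl dotZr.
  apply: le_lt_trans xe; rewrite mulrA.
  by apply: ler_piMl; [exact: dot_ge0|exact: mulr_ile1].
have cpath : continuous path by exact: continuous_line.
have con : connected (param c @` (path @` `[0, 1])).
  apply: connected_continuous_connected.
    apply: connected_continuous_connected; first exact: segment_connected.
    exact: continuous_subspaceT.
  apply: (continuous_subspaceW _ (param_continuous (c := c))).
  by move=> _ [s /path_img ? <-].
have I0 : `[0, 1]%classic (0 : R) by rewrite /= in_itv /= lexx ler01.
have I1 : `[0, 1]%classic (1 : R) by rewrite /= in_itv /= lexx ler01.
apply: (connected_component_max _ _ con) => //.
- exists (path 0); first by exists 0.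
  by rewrite /path scale0r addr0 coordK.
- exists (path 1); first by exists 1.
  by rewrite /path scale1r addrC subrK.
Qed.

(** A function [u] on a compact complex manifold whose expressions [g c] in the
    charts are pluriharmonic is locally constant. *)
Lemma pluriharmonic_locally_constant (u : M -> R) (g : chart X -> V -> R) :
  compact [set: M] ->
  (forall c p, dom c p -> g c (coord c p) = u p) ->
  (forall c, pluriharmonic_on (img c) (g c)) ->
  forall c x, img c x -> \forall y \near x, g c y = g c x.
Proof.
move=> cptM gu pg.
have g_param c x : img c x -> g c x = u (param c x).
  by move=> cx; rewrite -(gu c) ?paramK//; exact: dom_param.
have cu : continuous u.
  move=> p; have [c cp] := dom_cover X p.
  have cg : {for p, continuous (g c \o coord c)}.
    apply: continuous_comp; first exact: coord_continuous_at.
    have [dg _ _] := pg c.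
    exact/differentiable_continuous/dg/img_coord.
  rewrite /prop_for /continuous_at -(gu c p cp).
  apply: cvg_trans cg; apply: near_eq_cvg.
  have : \forall p' \near p, dom c p'.
    by apply: open_nbhs_nbhs; split => //; exact: dom_open.
  by apply: filterS => p' /gu.
move=> c0 _ [p c0p <-].
pose C := connected_component [set: M] p.
have closedC : closed C by apply: component_closed; exact: closedT.
have cptC : compact C by apply: (subclosed_compact closedC cptM).
have Cp : C p by exact: connected_component_refl.
have [||p1 + hp1] := @compact_EVT_max _ _ u C _ cptC.
- by exists p.
- exact: continuous_subspaceT.
rewrite inE => Cp1.
have umax q : C q -> u q <= u p1 by move=> Cq; apply: hp1; rewrite inE.
(* The strong maximum principle in a chart around a maximum point of u on C. *)
have near_max q c : C q -> u q = u p1 -> dom c q ->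
    \forall x \near coord c q,
      [/\ img c x, C (param c x) & g c x = u p1].
  move=> Cq uq cq.
  have [e e0 he] := dot_ball_sub (@img_open _ _ _ X c) (img_coord cq).
  have inC x : dot (x - coord c q) (x - coord c q) < e -> C (param c x).
    by move=> xe; apply: connected_component_trans Cq
      (param_connected_component cq he xe).
  pose U := [set x : V | dot (x - coord c q) (x - coord c q) < e].
  have oU : open U.
    apply: (@open_comp _ _ (fun x : V => dot (x - coord c q) (x - coord c q))
      [set t | t < e]); last exact: open_lt.
    by move=> x _; exact: continuous_dot.
  have Uq : U (coord c q) by rewrite /U /= subrr dot0l.
  have gq : g c (coord c q) = u p1 by rewrite gu.
  have gmax : \forall x \near coord c q, g c x = g c (coord c q).
    apply: (pluriharmonic_strong_maximum oU _ Uq).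
      exact: pluriharmonic_subset he (pg c).
    by move=> x xU; rewrite gq g_param; [exact/umax/inC|exact: he].
  have nU : \forall x \near coord c q, U x by exact: near_dot_ball.
  near=> x; have Ux : U x by near: x.
  split; [exact: he|exact: inC|].
  by rewrite -gq; near: x.
pose A := [set q | C q /\ u q = u p1].
have AC : A = C.
  apply: (@component_connected _ [set: M] p A); first by exists p1.
    exists (interior A); first exact: open_interior.
    apply/seteqP; split => [q Aq|q [_ /interior_subset//]].
    split; first by case: Aq.
    have [c cq] := dom_cover X q.
    have := near_max q c Aq.1 Aq.2 cq => /(coord_continuous_at cq) hq.
    have nq : \forall q' \near q, dom c q'.
      by apply: open_nbhs_nbhs; split => //; exact: dom_open.
    change (\forall q' \near q, A q'); near=> q'.
    have cq' : dom c q' by near: q'.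
    have [_ Cq' gq'] : [/\ img c (coord c q'), C (param c (coord c q'))
        & g c (coord c q') = u p1] by near: q'; exact: hq.
    by split; [rewrite -(coordK cq')|rewrite -(gu c)].
  exists (u @^-1` [set u p1]); last by apply/seteqP; split=> q [].
  by apply: closed_comp => [x _|]; [exact: cu|exact: closed_eq].
have [_ up] : A p by rewrite AC.
apply: filterS (near_max p c0 Cp up c0p) => y [_ _ ->].
by rewrite gu.
Unshelve. all: by end_near. Qed.

(** * The forms d f and d^c f *)

Lemma Jstd_Jstd (v : V) : Jstd (Jstd v) = - v.
Proof.
rewrite /Jstd row_mxKr row_mxKl; apply/esym.
by rewrite -{1}(hsubmxK v) opp_row_mx.
Qed.

Lemma derive_oppv (f : V -> R) x v :
  differentiable f x -> 'D_(- v) f x = - 'D_v f x.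
Proof. by move=> df; rewrite !deriveE// linearN. Qed.

Lemma cderive_oppv (f : V -> R[i]) x v :
  differentiable (fun y => complex.Re (f y)) x ->
  differentiable (fun y => complex.Im (f y)) x ->
  cderive (- v) f x = - cderive v f x.
Proof. by move=> dr di; rewrite /cderive !derive_oppv. Qed.

Lemma cderive_opp (f : V -> R[i]) x v :
  differentiable (fun y => complex.Re (f y)) x ->
  differentiable (fun y => complex.Im (f y)) x ->
  cderive v (fun y => - f y) x = - cderive v f x.
Proof.
move=> dr di; rewrite /cderive.
have -> : (fun y => complex.Re (- f y)) = - (fun y => complex.Re (f y)).
  by apply: funext => y; rewrite fctE; case: (f y).
have -> : (fun y => complex.Im (- f y)) = - (fun y => complex.Im (f y)).
  by apply: funext => y; rewrite fctE; case: (f y).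
by rewrite !deriveN//; exact: diff_derivable.
Qed.

Lemma eq_cderive (U : set V) (f g : V -> R[i]) x v : open U -> U x ->
  (forall y, U y -> f y = g y) -> cderive v f x = cderive v g x.
Proof.
move=> oU Ux fg; have nU : \forall y \near x, U y by exact: open_nbhs_nbhs.
by rewrite /cderive; congr (_ +i* _); apply: near_eq_derive;
  apply: filterS nU => y /fg ->.
Qed.

(** The expression in the chart [c] of the function underlying a 0-form;
    formally a 0-form takes an empty family of tangent vectors, for which the
    zero family is chosen. *)
Definition zero_form_fun (b : tensor X 0) (c : chart X) (x : V) : R[i] :=
  b c x (fun=> 0).

Lemma zero_form_funE (b : tensor X 0) c x v : b c x v = zero_form_fun b c x.
Proof. by congr (b c x _); apply: funext => -[]. Qed.

Lemma zero_form_fun_transition (b : tensor X 0) c c' p : smooth_form b ->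
  dom c p -> dom c' p ->
  zero_form_fun b c (coord c p) = zero_form_fun b c' (coord c' p).
Proof.
move=> [[_ comp _] _] cp c'p.
rewrite /zero_form_fun (comp c c') ?zero_form_funE /transition /= ?coordK//.
by exists p.
Qed.

Lemma smooth_zero_form_fun (b : tensor X 0) c k : smooth_form b ->
  C_on (img c) k (fun x => complex.Re (zero_form_fun b c x)) /\
  C_on (img c) k (fun x => complex.Im (zero_form_fun b c x)).
Proof. by move=> [[_ _ sm] _]; exact: sm. Qed.

(** The hypothesis says that [d d^c b = 0]; the conclusion is that [d b = 0]. *)
Lemma cderive_pluriharmonic_zero_form (b : tensor X 0) :
  compact [set: M] -> smooth_form b ->
  (forall c x v, img c x ->
    cderive v (cderive v (zero_form_fun b c)) x +
    cderive (Jstd v) (cderive (Jstd v) (zero_form_fun b c)) x = 0) ->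
  forall c x v, img c x -> cderive v (zero_form_fun b c) x = 0.
Proof.
move=> cptM sb lap.
have const (part : R[i] -> R) :
    (forall c, pluriharmonic_on (img c) (part \o zero_form_fun b c)) ->
    forall c x v, img c x -> 'D_v (part \o zero_form_fun b c) x = 0.
  move=> ph c x v cx.
  pose u p := let c := projT1 (cid (dom_cover X p)) in
    part (zero_form_fun b c (coord c p)).
  have gu c' p : dom c' p -> (part \o zero_form_fun b c') (coord c' p) = u p.
    rewrite /u; case: cid => c'' /= c''p c'p; congr (part _).
    exact: zero_form_fun_transition.
  have := pluriharmonic_locally_constant cptM gu ph cx.
  by move=> /(near_eq_derive v) ->; rewrite derive_cst.
move=> c x v cx.
have -> : cderive v (zero_form_fun b c) x =
  'D_v (@complex.Re R \o zero_form_fun b c) x +i*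
  'D_v (@complex.Im R \o zero_form_fun b c) x by [].
rewrite !const// => {cx}c'.
- have [_ [d1 d2]] := smooth_zero_form_fun c' 2 sb; split=> //.
    by move=> w y; apply: (d2 w).1.
  by move=> w y /(lap _ _ w) /(congr1 (@complex.Im R)).
- have [[d1 d2] _] := smooth_zero_form_fun c' 2 sb; split=> //.
    by move=> w y; apply: (d2 w).1.
  by move=> w y /(lap _ _ w) /(congr1 (@complex.Re R)).
Qed.

Lemma ext_d0E (b : tensor X 0) c x v :
  ext_d b c x v = cderive (v ord0) (zero_form_fun b c) x.
Proof.
rewrite /ext_d big_ord1 expr0 mul1r; congr (cderive _ _ x).
by apply: funext => y; rewrite zero_form_funE.
Qed.

Lemma ext_dc0E (b : tensor X 0) c x v :
  ext_dc b c x v = cderive (Jstd (v ord0)) (zero_form_fun b c) x.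
Proof.
rewrite /ext_dc /I_act ext_d0E; congr (cderive _ _ x).
by apply: funext => y; rewrite /zero_form_fun /I_inv zero_form_funE.
Qed.

Lemma ext_d1E (a : tensor X 1) c x v w :
  ext_d a c x (pair_vec v w) =
  cderive v (fun y => a c y (fun=> w)) x -
  cderive w (fun y => a c y (fun=> v)) x.
Proof.
rewrite /ext_d big_ord_recl big_ord1 expr0 mul1r expr1 mulN1r.
congr (cderive _ _ x - cderive _ _ x); apply: funext => y; congr (a c y _);
  by apply: funext => j; rewrite (ord1 j).
Qed.

Lemma ext_dc1E (a : tensor X 1) c x v w :
  ext_dc a c x (pair_vec v w) =
  cderive (Jstd v) (fun y => a c y (fun=> w)) x -
  cderive (Jstd w) (fun y => a c y (fun=> v)) x.
Proof.
rewrite /ext_dc /I_act.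
have -> : (fun j => Jstd (pair_vec v w j)) = pair_vec (Jstd v) (Jstd w).
  by apply: funext => j; rewrite /pair_vec; case: ifP.
by rewrite ext_d1E /I_inv !Jstd_Jstd !opprK.
Qed.

Lemma dc_closed_d_exact_eq0 (alpha : tensor X 1) :
  compact [set: M] -> d_exact alpha -> dc_closed alpha ->
  tensor_eq alpha tensor0.
Proof.
move=> cptM [b [sb alphaE]] alpha0 c x v cx.
rewrite alphaE// ext_d0E.
apply: cderive_pluriharmonic_zero_form => // {}c {}x w {}cx.
have [[_ dr] [_ di]] := smooth_zero_form_fun c 2 sb.
(* The value of d^c (d b) on (w, J w) is the Laplacian of b along w. *)
have := alpha0 c x (pair_vec w (Jstd w)) cx.
rewrite ext_dc1E Jstd_Jstd.
have E u u' : cderive u (fun y => alpha c y (fun=> u')) x =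
    cderive u (cderive u' (zero_form_fun b c)) x.
  apply: (@eq_cderive (img c)) => // [|y cy]; first exact: img_open.
  by rewrite alphaE// ext_d0E.
rewrite !E (@cderive_oppv (cderive w (zero_form_fun b c)) x w
  ((dr w).1 x cx) ((di w).1 x cx)) opprK => laplacian.
by rewrite addrC; exact: laplacian.
Qed.

Lemma d_closed_dc_exact_eq0 (alpha : tensor X 1) :
  compact [set: M] -> dc_exact alpha -> d_closed alpha ->
  tensor_eq alpha tensor0.
Proof.
move=> cptM [b [sb alphaE]] alpha0 c x v cx.
rewrite alphaE// ext_dc0E.
apply: cderive_pluriharmonic_zero_form => // {}c {}x w {}cx.
have [[dr0 dr] [di0 di]] := smooth_zero_form_fun c 2 sb.
(* The value of d (d^c b) on (J w, w) is the Laplacian of b along w. *)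
have := alpha0 c x (pair_vec (Jstd w) w) cx.
rewrite ext_d1E.
have E u u' : cderive u (fun y => alpha c y (fun=> u')) x =
    cderive u (cderive (Jstd u') (zero_form_fun b c)) x.
  apply: (@eq_cderive (img c)) => // [|y cy]; first exact: img_open.
  by rewrite alphaE// ext_dc0E.
rewrite !E Jstd_Jstd.
rewrite (@eq_cderive (img c) _ (fun y => - cderive w (zero_form_fun b c) y) x w
  (@img_open _ _ _ X c)) //; last first.
  by move=> y cy; rewrite cderive_oppv//; [exact: dr0|exact: di0].
rewrite (@cderive_opp (cderive w (zero_form_fun b c)) x w
  ((dr w).1 x cx) ((di w).1 x cx)) opprK => laplacian.
by rewrite addrC; exact: laplacian.
Qed.

End Manifold.

Theorem lemma2p1 (R : realType) (n : nat) (M : topologicalType)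
    (X : complex_manifold R n M) (M_compact : compact [set: M])
    (omega : tensor X 2) (omega_HS : hermitian_symplectic omega)
    (alpha : tensor X 1) (alpha_smooth : smooth_form alpha)
    (alpha_closed_exact : (d_exact alpha /\ dc_closed alpha) \/
                          (dc_exact alpha /\ d_closed alpha)) :
  tensor_eq alpha tensor0.
Proof.
case: alpha_closed_exact => -[exact_alpha closed_alpha].
  exact: dc_closed_d_exact_eq0.
exact: d_closed_dc_exact_eq0.
Qed.
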